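(* Let $\boldsymbol{\pi}\in\mathbb{R}^n$ be a vector with positive entries such that $\boldsymbol{\pi}^T\mathbf{1}=1$, and let $A \in \mathbb{R}^{n \times n}$ be a matrix with positive entries. Then there exist diagonal matrices $D_1$ and $D_2$ such that $$D_1 A D_2 \mathbf{1} = \mathbf{1}, \qquad \boldsymbol{\pi}^T D_1 A D_2 = \boldsymbol{\pi}^T.$$ Moreover, $D_1$ and $D_2$ are diagonal matrices such that $D_1\widehat A D_2 \mathbf{1}=\boldsymbol{\pi}$ and $\mathbf{1}^T D_1\widehat A D_2 =\boldsymbol{\pi}^T$, where $\widehat A=\mathrm{diag}(\boldsymbol{\pi})A$.
   Context: $\mathbf{1}=(1,\ldots,1)^T\in\mathbb{R}^n$; for a vector $\mathbf{x}$, $\operatorname{diag}(\mathbf{x})$ is the diagonal matrix with the entries of $\mathbf{x}$ on the diagonal. *)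

(* Defs.v *)
From HB Require Import structures.
From mathcomp Require Export all_boot all_order all_algebra.
From mathcomp Require Export reals.
Import Order.TTheory GRing.Theory Num.Theory.

Set Implicit Arguments.
Unset Strict Implicit.
Unset Printing Implicit Defensive.

Local Open Scope ring_scope.

Definition ones (R : realType) (n : nat) : 'cV[R]_n := const_mx 1.

(* [diag_mx] expects a row vector, whereas vectors here are columns. *)
Definition diag (R : realType) (n : nat) (x : 'cV[R]_n) : 'M[R]_n :=
  diag_mx x^T.

(* Main.v *)
Require Import Defs.
From mathcomp Require Import all_boot all_order all_algebra.
From mathcomp Require Import reals.
From mathcomp Require Import boolp classical_sets functions topology.
From mathcomp Require Import normedtype sequences derive exp ring lra.
Import Order.TTheory GRing.Theory Num.Theory.
Import numFieldNormedType.Exports.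

Set Implicit Arguments.
Unset Strict Implicit.
Unset Printing Implicit Defensive.

Local Open Scope ring_scope.

(** Existence of the scaling is a variational fact, in the spirit of Sinkhorn
    and Menon. Given positive weights [p] on rows and [q] on columns with the
    same total, consider on the positive cone the potential
      f(y) = sum_i p_i ln (A y)_i - sum_j q_j ln y_j.
    It is invariant under scaling of [y] ([potentialZ], where equality of the
    totals is used), and among vectors with maximal entry 1 it is large as soon
    as some entry is small ([potential_coercive]). Hence a minimum over a
    compact box [eps, 1]^n is a minimum over the whole cone ([potential_min]).

    At a minimizer [y] the partial derivatives of f vanish:
      y_j (sum_i p_i A_ij / (A y)_i) = q_j   for every j.
    Only one inequality has to be read off from minimality: increasing [y_j]
    and bounding logarithms by their tangents gives [>=]
    ([potential_min_le]), and both sides have the same sum over [j], so equality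
    holds ([exists_scaling]). With p = q = pi this says that
    D1 = diag (1 / A y) and D2 = diag y are as required.

    The second claim holds for any diagonal solution, because [D1] commutes
    with [diag pi]. *)

Lemma exists_pos_lower_bound (R : realType) (I : finType) (F : I -> R) :
  (forall i, 0 < F i) -> exists2 a, 0 < a & forall i, a <= F i.
Proof.
move=> F_gt0; case: (pickP (fun _ : I => true)) => [i0 _|I0]; last first.
  by exists 1 => // i; have := I0 i.
case: (@arg_minP _ R I i0 xpredT F isT) => i _ Fi_min.
by exists (F i) => // j; exact: Fi_min.
Qed.

(** The graph of the logarithm lies below its tangent at [u]. *)
Lemma lnB_le (R : realType) (u v : R) :
  0 < u -> 0 < v -> ln v - ln u <= (v - u) / u.
Proof.
move=> u_gt0 v_gt0; rewrite -ln_div ?posrE//.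
have -> : v / u = 1 + (v - u) / u by field; rewrite gt_eqF.
apply: le_ln1Dx; rewrite -subr_gt0 opprK.
have -> : (v - u) / u + 1 = v / u by field; rewrite gt_eqF.
exact: divr_gt0.
Qed.

(** The entry [(A y)_i], for a vector [y] stored as a row, the shape for which
    compactness of boxes is available. *)
Definition rowdot (R : realType) (m n : nat) (A : 'M[R]_(m, n))
    (y : 'rV[R]_n) (i : 'I_m) : R :=
  \sum_j A i j * y 0 j.

(** The function of [y] whose critical points in the positive cone are the
    column scalings of [A] with row weights [p] and column weights [q]. *)
Definition potential (R : realType) (m n : nat) (p : 'I_m -> R) (q : 'I_n -> R)
    (A : 'M[R]_(m, n)) (y : 'rV[R]_n) : R :=
  \sum_i p i * ln (rowdot A y i) - \sum_j q j * ln (y 0 j).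

(** The index [k] only witnesses that [n] is positive; the same holds for [k]
    in [potentialZ] and [potential_continuous], and for [k0] further on. *)
Lemma rowdot_gt0 (R : realType) (m n : nat) (A : 'M[R]_(m, n)) (y : 'rV[R]_n)
    (k : 'I_n) (i : 'I_m) :
  (forall i j, 0 < A i j) -> (forall j, 0 < y 0 j) -> 0 < rowdot A y i.
Proof.
move=> A_gt0 y_gt0; rewrite /rowdot (bigD1 k)//= ltr_pwDl ?mulr_gt0//.
by apply: sumr_ge0 => j _; rewrite mulr_ge0// ltW.
Qed.

Lemma potentialZ (R : realType) (m n : nat) (p : 'I_m -> R) (q : 'I_n -> R)
    (A : 'M[R]_(m, n)) (k : 'I_n) (c : R) (y : 'rV[R]_n) :
  \sum_i p i = \sum_j q j ->
  (forall i j, 0 < A i j) -> 0 < c -> (forall j, 0 < y 0 j) ->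
  potential p q A (c *: y) = potential p q A y.
Proof.
move=> pq A_gt0 c_gt0 y_gt0; rewrite /potential.
have -> : \sum_i p i * ln (rowdot A (c *: y) i) =
    (\sum_i p i) * ln c + \sum_i p i * ln (rowdot A y i).
  rewrite mulr_suml -big_split; apply: eq_bigr => i _ /=.
  have -> : rowdot A (c *: y) i = c * rowdot A y i.
    by rewrite /rowdot mulr_sumr; apply: eq_bigr => j _; rewrite mxE mulrCA.
  by rewrite lnM ?posrE// ?mulrDr// (rowdot_gt0 k).
have -> : \sum_j q j * ln ((c *: y) 0 j) =
    (\sum_j q j) * ln c + \sum_j q j * ln (y 0 j).
  rewrite mulr_suml -big_split; apply: eq_bigr => j _ /=.
  by rewrite mxE lnM ?posrE// mulrDr.
by rewrite pq opprD addrACA subrr add0r.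
Qed.

Lemma continuous_sum (R : realType) (T : topologicalType) (I : finType)
    (F : I -> T -> R) (x : T) :
  (forall i, {for x, continuous (F i)}) ->
  {for x, continuous (fun z => \sum_i F i z)}.
Proof.
move=> Fc; elim: (index_enum I) => [|i s IHs].
  have -> : (fun z => \sum_(i <- [::]) F i z) = cst 0.
    by apply/funext => z; rewrite big_nil.
  exact: cst_continuous.
have -> : (fun z => \sum_(j <- i :: s) F j z) =
    (fun z => F i z + \sum_(j <- s) F j z).
  by apply/funext => z; rewrite big_cons.
by apply: continuousD; [exact: Fc|exact: IHs].
Qed.

Lemma potential_continuous (R : realType) (m n : nat) (p : 'I_m -> R)
    (q : 'I_n -> R) (A : 'M[R]_(m, n)) (k : 'I_n) (y : 'rV[R]_n) :
  (forall i j, 0 < A i j) -> (forall j, 0 < y 0 j) ->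
  {for y, continuous (potential p q A)}.
Proof.
move=> A_gt0 y_gt0.
have coord j : {for y, continuous (fun z : 'rV[R]_n => z 0 j)}.
  exact: coord_continuous.
have rowc i : {for y, continuous (fun z => rowdot A z i)}.
  apply: continuous_sum => j; apply: continuousM; last exact: coord.
  exact: cst_continuous.
apply: continuousB; apply: continuous_sum => i.
- apply: continuousM; first exact: cst_continuous.
  apply: continuous_comp; first exact: rowc.
  by apply: continuous_ln; exact: (rowdot_gt0 k).
- apply: continuousM; first exact: cst_continuous.
  by apply: continuous_comp; [exact: coord|exact: continuous_ln].
Qed.

(** Among vectors with maximal entry 1, the potential is at least any prescribed
    [b] once some entry is small enough: the entry 1 bounds every [(A y)_i] below, while
    [- q_j ln y_j] is large and the other such terms are nonnegative. *)
Lemma potential_coercive (R : realType) (m n : nat) (p : 'I_m -> R)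
    (q : 'I_n -> R) (A : 'M[R]_(m, n)) (b : R) :
  (forall i, 0 < p i) -> (forall j, 0 < q j) -> (forall i j, 0 < A i j) ->
  exists2 eps, 0 < eps <= 1 &
    forall (y : 'rV[R]_n) (k j : 'I_n), (forall l, 0 < y 0 l <= 1) ->
      y 0 k = 1 -> y 0 j < eps -> b <= potential p q A y.
Proof.
move=> p_gt0 q_gt0 A_gt0.
have [a a_gt0 aA] := @exists_pos_lower_bound R _
  (fun ij : 'I_m * 'I_n => A ij.1 ij.2) (fun ij => A_gt0 ij.1 ij.2).
have [r r_gt0 rq] := exists_pos_lower_bound q_gt0.
(* With y_j < exp (- C / r), the term q_j ln y_j is at most - C, which
   compensates the difference between b and the lower bound on the rows. *)
set C := `|b - (\sum_i p i) * ln a|.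
have Cr_ge0 : 0 <= C / r by apply: divr_ge0; [exact: normr_ge0|exact: ltW].
exists (expR (- (C / r))).
  by rewrite expR_gt0 -[leRHS]expR0 ler_expR oppr_le0.
move=> y k j y01 yk1 yj_lt.
have y_gt0 l : 0 < y 0 l by case/andP: (y01 l).
have rows : (\sum_i p i) * ln a <= \sum_i p i * ln (rowdot A y i).
  rewrite mulr_suml; apply: ler_sum => i _; rewrite ler_wpM2l//.
    exact: ltW.
  rewrite ler_ln ?posrE// ?(rowdot_gt0 k)//.
  rewrite /rowdot (bigD1 k)//= yk1 mulr1 ler_wpDr//; last exact: (aA (i, k)).
  by apply: sumr_ge0 => l _; rewrite mulr_ge0// ltW.
have cols : \sum_j q j * ln (y 0 j) <= - C.
  rewrite (bigD1 j)//= -[leRHS]addr0 lerD//; last first.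
    apply: sumr_le0 => l _; rewrite mulr_ge0_le0//; first exact: ltW.
    by apply: ln_le0; case/andP: (y01 l).
  have lnyj : ln (y 0 j) <= - (C / r).
    by rewrite -[leRHS]expRK ler_ln ?posrE// ?expR_gt0// ltW.
  apply: (@le_trans _ _ (q j * - (C / r))); first by rewrite ler_wpM2l// ltW.
  rewrite mulrN lerN2.
  have {1}-> : C = r * (C / r) by field; rewrite gt_eqF.
  by rewrite ler_wpM2r.
have := ler_norm (b - (\sum_i p i) * ln a); rewrite -/C /potential.
lra.
Qed.

(** The potential attains its minimum over the positive cone. *)
Lemma potential_min (R : realType) (m n : nat) (p : 'I_m -> R)
    (q : 'I_n -> R) (A : 'M[R]_(m, n)) (k0 : 'I_n) :
  \sum_i p i = \sum_j q j ->
  (forall i, 0 < p i) -> (forall j, 0 < q j) -> (forall i j, 0 < A i j) ->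
  exists2 y : 'rV[R]_n, (forall j, 0 < y 0 j) &
    forall z : 'rV[R]_n, (forall j, 0 < z 0 j) ->
      potential p q A y <= potential p q A z.
Proof.
move=> pq p_gt0 q_gt0 A_gt0.
pose one : 'rV[R]_n := const_mx 1.
have [eps /andP[eps_gt0 eps_le1] coer] :=
  @potential_coercive R m n p q A (potential p q A one) p_gt0 q_gt0 A_gt0.
pose K : set 'rV[R]_n :=
  [set v : 'rV[R]_n | forall j, `[eps, 1]%classic (v ord0 j)]%classic.
have KE v : (v \in K) <-> (forall j, eps <= v 0 j <= 1).
  rewrite inE; split => Kv j; have := Kv j; by rewrite /= in_itv.
have Kone : one \in K by apply/KE => j; rewrite mxE eps_le1 lexx.
have Kc : compact K.
  apply: (@rV_compact _ _ (fun=> `[eps, 1]%classic)) => j.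
  exact: segment_compact.
have K_gt0 v : v \in K -> forall j, 0 < v 0 j.
  by move=> /KE Kv j; case/andP: (Kv j) => + _; exact: lt_le_trans.
have [||y Ky ymin] := @EVT_min_rV R n (potential p q A) K _ Kc.
- by exists one; rewrite inE in Kone.
- apply: continuous_in_subspaceT => v Kv.
  by apply: (@potential_continuous R m n p q A k0) => //; exact: K_gt0.
exists y => [|z z_gt0]; first exact: K_gt0.
(* Rescale z so that its maximal entry is 1: it then either lies in the box or
   has a small entry, and coercivity compares it with the all-ones vector. *)
case: (@arg_maxP _ R _ k0 xpredT (fun j => z 0 j) isT) => k _ zk_max.
have c_gt0 : 0 < (z 0 k)^-1 by rewrite invr_gt0.
rewrite -(potentialZ k0 pq A_gt0 c_gt0 z_gt0); set w := _ *: z.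
have w01 j : 0 < w 0 j <= 1.
  by rewrite mxE mulr_gt0//= mulrC ler_pdivrMr// mul1r; exact: zk_max.
have [/forallP Kw|] := boolP [forall j, eps <= w 0 j].
  by apply: ymin; apply/KE => j; rewrite Kw; case/andP: (w01 j).
rewrite negb_forall => /existsP[j]; rewrite -ltNge => wj.
apply: le_trans (ymin _ Kone) _; apply: (coer w k j) => //.
by rewrite mxE mulVf// gt_eqF.
Qed.

(** One half of the critical point equation: the derivative in direction [j] is
    nonnegative at a minimizer. *)
Lemma potential_min_le (R : realType) (m n : nat) (p : 'I_m -> R)
    (q : 'I_n -> R) (A : 'M[R]_(m, n)) (y : 'rV[R]_n) (j : 'I_n) :
  (forall i, 0 < p i) -> (forall j, 0 < q j) -> (forall i j, 0 < A i j) ->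
  (forall j, 0 < y 0 j) ->
  (forall z : 'rV[R]_n, (forall j, 0 < z 0 j) ->
    potential p q A y <= potential p q A z) ->
  q j <= y 0 j * \sum_i p i * A i j / rowdot A y i.
Proof.
move=> p_gt0 q_gt0 A_gt0 y_gt0 ymin; set S := \sum_i _.
have Ay_gt0 i : 0 < rowdot A y i by exact: (rowdot_gt0 j).
have S_ge0 : 0 <= S.
  by apply: sumr_ge0 => i _; rewrite divr_ge0 ?mulr_ge0 ?ltW.
have step t : 0 < t -> q j <= (y 0 j + t) * S.
  move=> t_gt0; pose z : 'rV[R]_n := y + t *: delta_mx 0 j.
  have zE l : z 0 l = y 0 l + t * (l == j)%:R by rewrite !mxE eqxx.
  have z_gt0 l : 0 < z 0 l.
    by rewrite zE ltr_wpDr// mulr_ge0 ?ler0n// ltW.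
  have AzE i : rowdot A z i = rowdot A y i + t * A i j.
    rewrite /rowdot; under eq_bigr do rewrite zE mulrDr.
    rewrite big_split; congr (_ + _) => /=; rewrite (bigD1 j)//= eqxx mulr1.
    by rewrite big1 ?addr0 1?mulrC// => l /negPf->; rewrite !mulr0.
  have rows : \sum_i p i * ln (rowdot A z i) - \sum_i p i * ln (rowdot A y i)
      <= t * S.
    rewrite -sumrB mulr_sumr; apply: ler_sum => i _; rewrite -mulrBr.
    have -> : t * (p i * A i j / rowdot A y i) =
        p i * ((rowdot A z i - rowdot A y i) / rowdot A y i).
      by rewrite AzE; field; rewrite gt_eqF.
    by rewrite ler_wpM2l ?lnB_le ?(rowdot_gt0 j)// ltW.
  have cols : q j * (t / (y 0 j + t)) <=
      \sum_l q l * ln (z 0 l) - \sum_l q l * ln (y 0 l).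
    rewrite -sumrB (bigD1 j)//= big1 => [|l /negPf lj]; last first.
      by rewrite zE lj mulr0 addr0 subrr.
    have zj : z 0 j = y 0 j + t by rewrite zE eqxx mulr1.
    rewrite addr0 -mulrBr ler_wpM2l//; first exact: ltW.
    have := lnB_le (z_gt0 j) (y_gt0 j); rewrite zj.
    have -> : (y 0 j - (y 0 j + t)) / (y 0 j + t) = - (t / (y 0 j + t)).
      by rewrite opprD addrA subrr add0r mulNr.
    lra.
  have := ymin z z_gt0; rewrite /potential => yz.
  have : q j * (t / (y 0 j + t)) <= t * S by lra.
  have yt_gt0 : 0 < y 0 j + t by rewrite addr_gt0.
  rewrite mulrCA ler_pM2l// ler_pdivrMr//.
  by rewrite mulrC.
(* Let t tend to 0. *)
apply/ler_addgt0Pr => e e_gt0.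
have S1_gt0 : 0 < S + 1 by rewrite ltr_wpDl.
apply: le_trans (step (e / (S + 1)) (divr_gt0 e_gt0 S1_gt0)) _.
rewrite mulrDl lerD2l mulrAC ler_pdivrMr// ler_pM2l//.
by rewrite lerDl.
Qed.

(** For a positive matrix and positive marginals [p], [q] of equal total, the
    row factors [p_i / (A y)_i] and the column factors [y_j] scale [A] to a
    matrix with row sums [p] and column sums [q]; the row sums are automatic. *)
Lemma exists_scaling (R : realType) (m n : nat) (p : 'I_m -> R)
    (q : 'I_n -> R) (A : 'M[R]_(m, n)) (k0 : 'I_n) :
  \sum_i p i = \sum_j q j ->
  (forall i, 0 < p i) -> (forall j, 0 < q j) -> (forall i j, 0 < A i j) ->
  exists2 y : 'rV[R]_n, (forall j, 0 < y 0 j) &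
    forall j, y 0 j * \sum_i p i * A i j / rowdot A y i = q j.
Proof.
move=> pq p_gt0 q_gt0 A_gt0.
have [y y_gt0 ymin] := potential_min k0 pq p_gt0 q_gt0 A_gt0.
exists y => // j; pose s l := y 0 l * \sum_i p i * A i l / rowdot A y i.
have qs l : 0 <= s l - q l by rewrite subr_ge0; exact: potential_min_le.
(* Both sides of the inequality have the same total, so all the gaps vanish. *)
have sum_s : \sum_l (s l - q l) = 0.
  rewrite sumrB -pq; apply/eqP; rewrite subr_eq0; apply/eqP.
  rewrite /s; under eq_bigr do rewrite mulr_sumr.
  rewrite exchange_big /=; apply: eq_bigr => i _.
  have Ay0 : rowdot A y i != 0 by rewrite gt_eqF// (rowdot_gt0 k0).
  transitivity (p i / rowdot A y i * rowdot A y i); last by rewrite divfK.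
  by rewrite {3}/rowdot mulr_sumr; apply: eq_bigr => l _; field.
by apply/eqP; rewrite -subr_eq0; apply/eqP/(psumr_eq0P _ sum_s).
Qed.

Theorem proposition4p8 (R : realType) (n : nat)
    (pi : 'cV[R]_n) (A : 'M[R]_n)
    (pi_gt0 : forall i : 'I_n, 0 < pi i 0)
    (pi_sum1 : pi^T *m ones R n = 1%:M)
    (A_gt0 : forall i j : 'I_n, 0 < A i j) :
  (exists D1 D2 : 'M[R]_n,
      [/\ is_diag_mx D1, is_diag_mx D2,
          D1 *m A *m D2 *m ones R n = ones R n
        & pi^T *m D1 *m A *m D2 = pi^T])
  /\
  (forall D1 D2 : 'M[R]_n,
      is_diag_mx D1 -> is_diag_mx D2 ->
      D1 *m A *m D2 *m ones R n = ones R n ->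
      pi^T *m D1 *m A *m D2 = pi^T ->
      let Ahat := diag pi *m A in
      D1 *m Ahat *m D2 *m ones R n = pi /\
      (ones R n)^T *m D1 *m Ahat *m D2 = pi^T).
Proof.
split.
  case: n pi A pi_gt0 pi_sum1 A_gt0 => [|n] pi A pi_gt0 pi_sum1 A_gt0.
    (* For n = 0 all the matrices involved are empty. *)
    by exists 0, 0; split; rewrite ?mx0_is_diag//; apply/matrixP => i j;
      [case: i|case: j].
  have [y y_gt0 scaled] := @exists_scaling R _ _ (fun i => pi i 0)
    (fun j => pi j 0) A ord0 erefl pi_gt0 pi_gt0 A_gt0.
  exists (diag_mx (\row_i (rowdot A y i)^-1)), (diag_mx y).
  split; rewrite ?diag_mx_is_diag//; apply/matrixP => i j.
    rewrite mul_diag_mx mul_mx_diag !mxE.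
    have Ay0 : rowdot A y i != 0 by rewrite gt_eqF// (rowdot_gt0 ord0).
    rewrite -[RHS](mulVf Ay0) {2}/rowdot mulr_sumr; apply: eq_bigr => l _.
    by rewrite !mxE mulr1 mulrA.
  rewrite !mul_mx_diag !mxE (ord1 i) -[RHS]scaled mulrC.
  congr (_ * _); apply: eq_bigr => l _; rewrite !mxE.
  by rewrite mulrAC.
move=> D1 D2 /diag_mxP[d1 D1E] D2d rows cols Ahat.
have comm : D1 *m diag pi = diag pi *m D1 by rewrite D1E /diag diag_mxC.
have pione : diag pi *m ones R n = pi.
  by apply/matrixP => i j; rewrite /diag mul_diag_mx !mxE mulr1 (ord1 j).
have onepi : (ones R n)^T *m diag pi = pi^T.
  by apply/matrixP => i j; rewrite /diag mul_mx_diag !mxE mul1r (ord1 i).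
split.
  by rewrite /Ahat mulmxA comm -!mulmxA (mulmxA D1) (mulmxA (D1 *m A)) rows.
by rewrite /Ahat -!mulmxA (mulmxA D1) comm !mulmxA onepi.
Qed.
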